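(* Let $K\subseteq\mathbb{R}^n$ be nonempty and closed and let $f=(f_1,\dots,f_m):K\to\mathbb{R}^m$ be continuous. Assume that the domain $\operatorname{dom}\Theta_1$ of the solution mapping $\Theta_1:\Delta\rightrightarrows\mathbb{R}^n$ is non-closed. Then the weak Pareto solution set $\operatorname{Sol}^w(K,f)$ is unbounded. Moreover, the Pareto solution set $\operatorname{Sol}(K,f)$ is unbounded provided that $(\operatorname{ri}\Delta)\cap\operatorname{dom}\Theta_1$ is dense in $\operatorname{dom}\Theta_1$.
   Context: $\Delta=\{(\xi_1,\dots,\xi_m)\in\mathbb{R}^m_+:\xi_1+\dots+\xi_m=1\}$ is the standard simplex; its relative interior $\operatorname{ri}\Delta$ consists of the $\xi\in\Delta$ with all coordinates positive. For $\xi\in\Delta$, $f_\xi=\xi_1f_1+\dots+\xi_mf_m$, and $\Theta_1(\xi)$ is the set of global minimizers of $f_\xi$ over $K$. $\operatorname{dom}\Theta_1=\{\xi\in\Delta:\Theta_1(\xi)\neq\emptyset\}$. A point $x\in K$ is a Pareto solution (an element of $\operatorname{Sol}(K,f)$) if there is no $y\in K$ with $f(y)-f(x)\in-\mathbb{R}^m_+\setminus\{0\}$; it is a weak Pareto solution (an element of $\operatorname{Sol}^w(K,f)$) if there is no $y\in K$ with $f(y)-f(x)\in-\operatorname{int}\mathbb{R}^m_+$. *)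

(* Defs.v *)
From mathcomp Require Import all_boot all_order all_algebra.
From mathcomp Require Import all_classical all_reals all_analysis.

Set Implicit Arguments.
Unset Strict Implicit.
Unset Printing Implicit Defensive.

Import Order.TTheory GRing.Theory Num.Theory.
Import numFieldNormedType.Exports.

Local Open Scope classical_set_scope.
Local Open Scope ring_scope.

Section VectorOptimization.
Context {R : realType}.

Definition orthant (m : nat) : set 'rV[R]_m :=
  [set v | forall i, 0 <= v ord0 i].

Definition simplex (m : nat) : set 'rV[R]_m :=
  [set xi | orthant xi /\ \sum_(i < m) xi ord0 i = 1].

Definition ri_simplex (m : nat) : set 'rV[R]_m :=
  [set xi | simplex xi /\ forall i, 0 < xi ord0 i].

(* The map [f : K -> R^m] is represented by a total function; the definitions
   below, and continuity [{within K, _}], only depend on its values on [K]. *)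
Variables (n m : nat) (K : set 'rV[R]_n) (f : 'rV[R]_n -> 'rV[R]_m).

Definition scalarization (xi : 'rV[R]_m) (x : 'rV[R]_n) : R :=
  \sum_(i < m) xi ord0 i * f x ord0 i.

(* Only meant for [xi] in the simplex. *)
Definition Theta1 (xi : 'rV[R]_m) : set 'rV[R]_n :=
  [set x | K x /\
           forall y, K y -> scalarization xi x <= scalarization xi y].

Definition dom_Theta1 : set 'rV[R]_m :=
  [set xi | simplex xi /\ Theta1 xi !=set0].

Definition Sol : set 'rV[R]_n :=
  [set x | K x /\
           ~ exists2 y, K y &
               ((-%R @` @orthant m) `\` [set 0]) (f y - f x)].

Definition Solw : set 'rV[R]_n :=
  [set x | K x /\
           ~ exists2 y, K y & (-%R @` interior (@orthant m)) (f y - f x)].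

End VectorOptimization.

(* Main.v *)
Require Import Defs.
From mathcomp Require Import all_boot all_order all_algebra.
From mathcomp Require Import all_classical all_reals all_analysis.
From mathcomp Require Import lra.

Import Order.TTheory GRing.Theory Num.Theory.
Import numFieldNormedType.Exports.

Local Open Scope classical_set_scope.
Local Open Scope ring_scope.

(** Both conclusions follow by contraposition from one closedness principle.
    Let [G] be a dense part of [dom Theta_1] and suppose that the minimizers of
    all the problems [min_K f_eta], [eta] in [G], lie in one bounded set.  Then
    they lie in a compact set [C], contained in [K].  A limit [xi] of points of
    [G] is again in [dom Theta_1]: a minimizer [x0] of [f_xi] over [C] is in
    fact a minimizer over [K], since no [y] in [K] can beat it by any
    positive amount.  Indeed for [eta] in [G] close to [xi], the values of
    [f_xi] and [f_eta] are close, uniformly on [C] and also at [y], while some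
    minimizer of [f_eta] over [K] belongs to [C] ([closure_sub_dom_Theta1]).
    Hence [dom Theta_1] would be closed.

    Minimizers of [f_xi] are weak Pareto solutions for every [xi] in the simplex
    and Pareto solutions when all the weights are positive, so that the
    principle applies to [G = dom Theta_1] and the weak Pareto set, and to
    [G = ri Delta `&` dom Theta_1] and the Pareto set. *)

Lemma simplex_closed (R : realType) (m : nat) : closed (@simplex R m).
Proof.
have clo : closed (@orthant R m).
  have -> : @orthant R m =
      \bigcap_(i in [set: 'I_m])
        ((fun v => v ord0 i) @^-1` [set t : R | 0 <= t]).
    by apply/seteqP; split=> v Hv => [i _|i]; exact: Hv.
  apply: closed_bigI => i _; apply: preimage_closed; last exact: closed_ge.
  by move=> v _; exact: coord_continuous.
apply: (closedI clo).
apply: (@preimage_closed _ _ (fun xi : 'rV[R]_m => \sum_(i < m) xi ord0 i)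
  [set t : R | t = 1]); last exact: closed_eq.
move=> v _; apply: continuous_big => [|i _]; first exact: add_continuous.
exact: coord_continuous.
Qed.

Lemma interior_orthant_gt0 (R : realType) (m : nat) (v : 'rV[R]_m) :
  interior (@orthant R m) v -> forall i, 0 < v ord0 i.
Proof.
move=> /nbhs_ballP[e /= e0 ve] i.
have : ball v e (v - const_mx (e / 2)).
  split=> // a b; rewrite /ball/= !mxE opprB addrCA subrr addr0.
  by rewrite ger0_norm ?ltW ?divr_gt0// gtr_pMr// invf_lt1// ltr1n.
move=> /ve /(_ i); rewrite !mxE subr_ge0; apply: lt_le_trans.
by rewrite divr_gt0.
Qed.

Section scalarized_problems.
Context (R : realType) (n m : nat).
Implicit Types (K S : set 'rV[R]_n) (f : 'rV[R]_n -> 'rV[R]_m).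
Implicit Types (xi eta : 'rV[R]_m).

Lemma scalarizationB f xi x y :
  scalarization f xi y - scalarization f xi x =
  \sum_(i < m) xi ord0 i * (f y - f x) ord0 i.
Proof.
by rewrite /scalarization -sumrB; apply: eq_bigr => i _; rewrite !mxE mulrBr.
Qed.

Lemma scalarization_dist f xi eta x :
  `|scalarization f xi x - scalarization f eta x| <=
  `|xi - eta| * (m%:R * `|f x|).
Proof.
have coord_le (v : 'rV[R]_m) i : `|v ord0 i| <= `|v|.
  rewrite [leRHS]/Num.norm /= mx_normrE.
  by apply/bigmax_geP; right; exists (ord0, i).
rewrite /scalarization -sumrB (le_trans (ler_norm_sum _ _ _))//.
apply: (@le_trans _ _ (\sum_(i < m) `|xi - eta| * `|f x|)); last first.
  by rewrite sumr_const card_ord -[leLHS]mulr_natl mulrCA.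
apply: ler_sum => i _; rewrite -mulrBl normrM ler_pM//.
by have := coord_le (xi - eta) i; rewrite !mxE.
Qed.

Lemma scalarization_continuous K f xi : {within K, continuous f} ->
  {within K, continuous (scalarization f xi)}.
Proof.
move=> cf x; apply: cvg_big => [|i _]; first exact: add_continuous.
apply: cvgMr; apply: (@cvg_comp _ _ _ f (fun v : 'rV[R]_m => v ord0 i)).
  exact: cf.
exact: coord_continuous.
Qed.

(** A point improving every objective strictly has a smaller weighted sum,
    because the weights are nonnegative and not all zero. *)
Lemma Theta1_sub_Solw K f xi : simplex xi -> Theta1 K f xi `<=` Solw K f.
Proof.
move=> [xi0 xi1] x [Kx xmin]; split=> // -[y Ky [v vint vE]].
have v0 := interior_orthant_gt0 _ _ _ vint.
have := xmin y Ky; rewrite -subr_ge0 scalarizationB -vE leNgt => /negP; apply.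
under eq_bigr do rewrite mxE mulrN.
rewrite sumrN oppr_lt0 lt_neqAle eq_sym psumr_neq0 => [|i _]; last first.
  by rewrite mulr_ge0 ?xi0// ltW.
rewrite sumr_ge0 ?andbT => [|i _]; last by rewrite mulr_ge0 ?xi0// ltW.
apply: contraT => /hasPn xi_le0.
suff : \sum_(i < m) xi ord0 i = 0 by move/eqP; rewrite xi1 oner_eq0.
apply: big1 => i _; apply/eqP; rewrite eq_le xi0 andbT leNgt.
have /= := xi_le0 i (mem_index_enum i).
by apply: contra => xi_gt0; rewrite mulr_gt0.
Qed.

(** With positive weights, improving a single objective without worsening the
    others already decreases the weighted sum. *)
Lemma Theta1_sub_Sol K f xi : ri_simplex xi -> Theta1 K f xi `<=` Sol K f.
Proof.
move=> [_ xi0] x [Kx xmin]; split=> // -[y Ky [[v v0 vE] fxy_neq0]].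
apply: fxy_neq0; have := xmin y Ky.
rewrite -subr_ge0 scalarizationB -vE.
under eq_bigr do rewrite mxE mulrN.
rewrite sumrN oppr_ge0 => sum_le0.
have sum0 : \sum_(i < m) xi ord0 i * v ord0 i == 0.
  rewrite eq_le sum_le0 sumr_ge0// => i _.
  by rewrite mulr_ge0 ?v0 ?(ltW (xi0 _)).
suff -> : v = 0 by rewrite /= oppr0.
apply/rowP => i; rewrite mxE; apply/eqP.
move: sum0; rewrite psumr_eq0 => [/allP/(_ i (mem_index_enum i))/=|j _];
  last first.
  by rewrite mulr_ge0 ?v0 ?(ltW (xi0 _)).
by rewrite mulf_eq0 gt_eqF.
Qed.

(** Stability of solvability: limits of weights whose problems have solutions
    in a common bounded set again have solutions. *)
Lemma closure_sub_dom_Theta1 K f (G : set 'rV[R]_m) S :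
    closed K -> {within K, continuous f} -> bounded_set S ->
    G `<=` dom_Theta1 K f -> (forall xi, G xi -> Theta1 K f xi `<=` S) ->
  closure G `<=` dom_Theta1 K f.
Proof.
move=> Kcl fcont [B [_ SB]] Gdom GS xi Gxi.
have xi_simplex : simplex xi.
  have /closure_id -> := simplex_closed R m.
  by apply: closureS Gxi => eta /Gdom[].
split=> //.
pose C := K `&` [set x | `|x| <= B + 1].
have SC eta x : G eta -> Theta1 K f eta x -> C x.
  move=> Geta xeta; split; first by case: xeta.
  by apply: (SB (B + 1)); [rewrite ltrDl | exact: GS xeta].
have Ccompact : compact C.
  apply: bounded_closed_compact.
    exists (B + 1); split; first exact: num_real.
    by move=> M BM x [_ /= xB]; rewrite (le_trans xB)// ltW.
  apply: closedI => //.
  apply: (@preimage_closed _ _ _ [set t : R | t <= B + 1]).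
    by move=> x _; exact: norm_continuous.
  exact: closed_le.
have fC : {within C, continuous f} by apply: continuous_subspaceW fcont => x [].
have C0 : C !=set0.
  have [eta [Geta _]] := Gxi _ (filterT : nbhs xi setT).
  have [_ [x xeta]] := Gdom _ Geta.
  by exists x; exact: SC xeta.
have [x0 /set_mem Cx0 x0min] :=
  compact_EVT_min C0 Ccompact (scalarization_continuous _ _ xi fC).
exists x0; split=> [|y Ky]; first by case: Cx0.
have [M0 [_ M0f]] := compact_bounded (continuous_compact fC Ccompact).
pose M := Num.max (M0 + 1) `|f y|.
have M_ge0 : 0 <= M by rewrite le_max normr_ge0 orbT.
have CM x : C x -> `|f x| <= M.
  move=> Cx; rewrite le_max; apply/orP; left.
  by apply: (M0f (M0 + 1)); [rewrite ltrDl | exists x].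
have yM : `|f y| <= M by rewrite le_max lexx orbT.
apply/ler_addgt0Pr => e e0.
(* replacing eta by xi changes the values at a minimizer of f_eta and at y,
   each by at most [|xi - eta| * (m * M)]; the [+ 1] keeps the divisor
   positive when [m * M = 0] *)
pose d := e / 2 / (m%:R * M + 1).
have mM_gt0 : 0 < m%:R * M + 1 by rewrite ltr_wpDl// mulr_ge0.
have d0 : 0 < d by rewrite !divr_gt0.
have [eta [Geta]] := Gxi _ (nbhsx_ballx xi d d0).
rewrite -ball_normE /= => xieta.
have [_ [x xeta]] := Gdom _ Geta.
have close z : `|f z| <= M ->
    `|scalarization f xi z - scalarization f eta z| <= e / 2.
  move=> zM; rewrite (le_trans (scalarization_dist _ _ _ _))//.
  have -> : e / 2 = d * (m%:R * M + 1) by rewrite divfK// gt_eqF.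
  rewrite ler_pM ?mulr_ge0// ?ltW//.
  by rewrite (@le_lt_trans _ _ (m%:R * M)) ?ltrDl// ler_wpM2l.
have Cx := SC _ _ Geta xeta.
have := x0min x (mem_set Cx).
have := xeta.2 y Ky.
have := close x (CM x Cx); have := close y yM.
rewrite !ler_norml => /andP[+ _] /andP[_ +].
lra.
Qed.

End scalarized_problems.

Theorem theorem5p2 (R : realType) (n m : nat)
    (K : set 'rV[R]_n) (f : 'rV[R]_n -> 'rV[R]_m)
    (K_nonempty : K !=set0) (K_closed : closed K)
    (f_continuous : {within K, continuous f})
    (dom_nonclosed : ~ closed (dom_Theta1 K f)) :
  ~ bounded_set (Solw K f) /\
  (dom_Theta1 K f `<=` closure (@ri_simplex R m `&` dom_Theta1 K f) ->
   ~ bounded_set (Sol K f)).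
Proof.
split=> [Solw_bounded|ri_dense Sol_bounded]; apply: dom_nonclosed.
  apply: closure_sub_dom_Theta1 K_closed f_continuous Solw_bounded _ _ => //.
  by move=> xi [xi_simplex _]; exact: Theta1_sub_Solw.
set G := @ri_simplex R m `&` dom_Theta1 K f in ri_dense.
have G_dom : closure G `<=` dom_Theta1 K f.
  apply: closure_sub_dom_Theta1 K_closed f_continuous Sol_bounded _ _.
    exact: subIsetr.
  by move=> xi [xi_ri _]; exact: Theta1_sub_Sol.
apply: subset_trans G_dom.
by have /closure_id -> := @closed_closure _ G; exact: closureS.
Qed.
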